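(* For $i=1,2$ consider forward complete systems $\Sigma_i:\ \frac{d}{dt}x_i(t)=f_i(x_i(t),w_i(t))$ with $x_i(0)\in\mathbb{R}^{n_i}$, $w_i\in\mathcal{W}^{m_i}$, where $f_i:\mathbb{R}^{n_i}\times\mathbb{R}^{m_i}\to\mathbb{R}^{n_i}$ is locally Lipschitz in its first argument, locally uniformly in its second argument, and $m_1=n_2$. Suppose both systems are iISS with functions $\alpha_i,\beta_i,\gamma_i,\sigma_i\in\mathcal{K}_\infty$: $$\int_0^t\alpha_i(|x_i(\tau)|)d\tau\le\max\left\{\beta_i(|x_i(0)|),\ \gamma_i\left(\int_0^t\sigma_i(|w_i(\tau)|)d\tau\right)\right\}$$ for all $x_i(0)\in\mathbb{R}^{n_i}$, $w_i\in\mathcal{W}^{m_i}$, $t\ge0$. Suppose the systems are connected in cascade with $w_1=x_2$. Let $T_i:\mathbb{R}^{n_i}\to\mathbb{R}^{n_i}$ and $S_i:\mathbb{R}^{m_i}\to\mathbb{R}^{m_i}$, $i=1,2$, be changes of coordinates in which $\Sigma_1$ and $\Sigma_2$ satisfy nonlinear $\mathcal{L}_2$-gain bounds, i.e. for some $\hat\beta_i,\hat\gamma_i\in\mathcal{K}_\infty$, $$\|T_i(x_i)\|_{\mathcal{L}_2[0,t]}^2\le\max\left\{\hat\beta_i(|T_i(x_i(0))|),\ \hat\gamma_i\left(\|S_i(w_i)\|_{\mathcal{L}_2[0,t]}^2\right)\right\}$$ for all $x_i(0)\in\mathbb{R}^{n_i}$, $w_i\in\mathcal{W}^{m_i}$,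 $t\ge0$ (for iISS systems such changes of coordinates always exist). If there exists $c>0$ such that $$|S_1(\zeta)|\le\sqrt{c}\,|T_2(\zeta)|\quad\text{for all }\zeta\in\mathbb{R}^{n_2},$$ then the cascade interconnection is iISS (from input $w_2$ to state $x=[x_1^T\ x_2^T]^T$); that is, there exist $\alpha,\beta,\gamma,\sigma\in\mathcal{K}_\infty$ such that $$\int_0^t\alpha(|x(\tau)|)d\tau\le\max\left\{\beta(|x(0)|),\ \gamma\left(\int_0^t\sigma(|w_2(\tau)|)d\tau\right)\right\}$$ for all $x(0)\in\mathbb{R}^{n_1+n_2}$, $w_2\in\mathcal{W}^{m_2}$, $t\ge0$.
   Context: $\mathcal{W}^m$ is the set of measurable, locally essentially bounded functions $w:\mathbb{R}_{\ge0}\to\mathbb{R}^m$. Forward complete means that for every initial condition and every input in the input class the solution exists for all $t\ge 0$. $\mathcal{K}_\infty$ is the class of continuous, strictly increasing, unbounded functions $\alpha:\mathbb{R}_{\ge0}\to\mathbb{R}_{\ge0}$ with $\alpha(0)=0$. $|\cdot|$ is the Euclidean norm, and $\|y\|_{\mathcal{L}_2[0,t]}^2:=\int_0^t|y(\tau)|^2d\tau$; $T_i(x_i)$ and $S_i(w_i)$ denote the functions $\tau\mapsto T_i(x_i(\tau))$ and $\tau\mapsto S_i(w_i(\tau))$. A change of coordinates is a homeomorphism $T:\mathbb{R}^p\to\mathbb{R}^p$ with $T(0)=0$ (differentiability is not required). iISS stands for integral input-to-state stable. *)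

(* Defs.v *)
From HB Require Import structures.
From mathcomp Require Import all_boot all_order all_algebra.
From mathcomp Require Import all_classical all_reals all_analysis.

Set Implicit Arguments.
Unset Strict Implicit.
Unset Printing Implicit Defensive.

Import Order.TTheory GRing.Theory Num.Theory.
Import numFieldNormedType.Exports.

Local Open Scope classical_set_scope.
Local Open Scope ring_scope.

(* The norm `|v| of the library on matrices is the sup norm. *)
Definition enorm (R : realType) (n : nat) (v : 'cV[R]_n) : R :=
  Num.sqrt (\sum_(i < n) v i 0 ^+ 2).

(* The real line with the sigma-algebra of Lebesgue measurable sets; the
   library's [lebesgue_measure] lives on the Borel sigma-algebra. *)
Definition lebesgueType (R : realType) : measurableType _ :=
  caratheodory_type ((@wlength R idfun)^*)%mu.

Definition leb (R : realType) : {measure set (lebesgueType R) -> \bar R} :=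
  @completed_lebesgue_measure R.

(* [Rintegral] sends divergent integrals to 0. All integrands below are
   nonnegative and locally essentially bounded (continuous functions of a
   continuous trajectory or of an input), so the integrals are finite. *)
Definition int0 (R : realType) (g : R -> R) (t : R) : R :=
  Rintegral (@leb R) `[0, t]%classic g.

Definition sqL2 (R : realType) (n : nat) (y : R -> 'cV[R]_n) (t : R) : R :=
  int0 (fun s => enorm (y s) ^+ 2) t.

(* A function from R>=0 to R>=0 is encoded as a map R -> R whose values at
   negative arguments are irrelevant; strict monotonicity and a 0 = 0 make it
   nonnegative on R>=0. *)
Definition Kinf (R : realType) (a : R -> R) : Prop :=
  [/\ {within [set r | 0 <= r], continuous a},
      {in [pred r | 0 <= r] &, {homo a : r s / r < s}},
      (forall M : R, exists2 r : R, 0 <= r & M < a r)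
    & a 0 = 0].

(* Signals on R>=0 are maps defined on R; only times t >= 0 matter. *)
Definition input (R : realType) (m : nat) (w : R -> 'cV[R]_m) : Prop :=
  (forall i, measurable_fun ([set t | 0 <= t] : set (lebesgueType R))
               (fun t : lebesgueType R => (w t i 0 : measurableTypeR R)))
  /\ (forall b : R, exists M : R,
        \forall t \ae @leb R, 0 <= t <= b -> enorm (w t) <= M).

Definition abs_continuous (R : realType) (a b : R) (g : R -> R) : Prop :=
  forall e : R, 0 < e -> exists2 d : R, 0 < d &
    forall (n : nat) (u v : 'I_n -> R),
      (forall i, [/\ a <= u i, u i <= v i & v i <= b]) ->
      trivIset setT (fun i => (`]u i, v i[%classic : set R)) ->
      \sum_(i < n) (v i - u i) < d ->
      \sum_(i < n) `|g (v i) - g (u i)| < e.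

(* Caratheodory solutions on R>=0 of x' = f(x, w). *)
Definition solution (R : realType) (n m : nat)
    (f : 'cV[R]_n -> 'cV[R]_m -> 'cV[R]_n)
    (w : R -> 'cV[R]_m) (x : R -> 'cV[R]_n) : Prop :=
  (forall (b : R) (i : 'I_n), abs_continuous 0 b (fun t => x t i 0))
  /\ \forall t \ae @leb R, 0 < t -> forall i,
       is_derive (t : R) (1 : R) (fun s : R => x s i 0) (f (x t) (w t) i 0).

Definition forward_complete (R : realType) (n m : nat)
    (f : 'cV[R]_n -> 'cV[R]_m -> 'cV[R]_n) : Prop :=
  forall (x0 : 'cV[R]_n) (w : R -> 'cV[R]_m), input w ->
    exists2 x, x 0 = x0 & solution f w x.

Definition locally_lipschitz_state (R : realType) (n m : nat)
    (f : 'cV[R]_n -> 'cV[R]_m -> 'cV[R]_n) : Prop :=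
  forall (x0 : 'cV[R]_n) (w0 : 'cV[R]_m), exists r L : R, 0 < r /\
    forall x y w, enorm (x - x0) < r -> enorm (y - x0) < r ->
      enorm (w - w0) < r -> enorm (f x w - f y w) <= L * enorm (x - y).

Definition iISS_estimate (R : realType) (n m : nat)
    (f : 'cV[R]_n -> 'cV[R]_m -> 'cV[R]_n) (a b g s : R -> R) : Prop :=
  forall w x, input w -> solution f w x -> forall t : R, 0 <= t ->
    int0 (fun u => a (enorm (x u))) t <=
      Num.max (b (enorm (x 0))) (g (int0 (fun u => s (enorm (w u))) t)).

Definition L2_gain (R : realType) (n m : nat)
    (f : 'cV[R]_n -> 'cV[R]_m -> 'cV[R]_n)
    (T : 'cV[R]_n -> 'cV[R]_n) (S : 'cV[R]_m -> 'cV[R]_m)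
    (b g : R -> R) : Prop :=
  forall w x, input w -> solution f w x -> forall t : R, 0 <= t ->
    sqL2 (T \o x) t <= Num.max (b (enorm (T (x 0)))) (g (sqL2 (S \o w) t)).

Definition coordinate_change (R : realType) (p : nat)
    (T : 'cV[R]_p -> 'cV[R]_p) : Prop :=
  [/\ continuous T, T 0 = 0
    & exists T', [/\ continuous T', cancel T T' & cancel T' T]].

(* State [x1; x2], input w2, with the first system driven by w1 = x2. *)
Definition cascade (R : realType) (n1 n2 m2 : nat)
    (f1 : 'cV[R]_n1 -> 'cV[R]_n2 -> 'cV[R]_n1)
    (f2 : 'cV[R]_n2 -> 'cV[R]_m2 -> 'cV[R]_n2)
    (x : 'cV[R]_(n1 + n2)) (w2 : 'cV[R]_m2) : 'cV[R]_(n1 + n2) :=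
  col_mx (f1 (usubmx x) (dsubmx x)) (f2 (dsubmx x) w2).

(* Main.v *)
(** In the new coordinates the condition |S1| <= sqrt c |T2| bounds the input energy
    of the first system by c times the output energy of the second, so the two gain
    bounds compose and bound the integral of |T1 x1|^2 + |T2 x2|^2. It remains to
    compare with the original coordinates: a continuous map vanishing at 0 satisfies
    |T x| <= rho |x| for some continuous increasing rho, obtained from the
    maximum of |T| over balls. Applied to T1, T2 and S2 this bounds the right-hand
    sides; applied to the inverses of T1 and T2 it bounds the integrand from below
    by a function of |x|. *)
Require Import Defs.
From mathcomp Require Import all_boot all_order all_algebra.
From mathcomp Require Import all_classical all_reals all_analysis.
From mathcomp Require Import measurable_realfun lra.

Set Implicit Arguments.
Unset Strict Implicit.
Unset Printing Implicit Defensive.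

Import Order.TTheory GRing.Theory Num.Theory.
Import numFieldNormedType.Exports.

Local Open Scope classical_set_scope.
Local Open Scope ring_scope.

(** * Euclidean norm: stacked vectors and continuity *)

Section EuclideanNorm.
Context {R : realType}.

Lemma enorm_ge0 n (v : 'cV[R]_n) : 0 <= enorm v.
Proof. exact: sqrtr_ge0. Qed.

Lemma enorm0 n : enorm (0 : 'cV[R]_n) = 0.
Proof.
by rewrite /enorm big1 ?sqrtr0// => i _; rewrite mxE expr0n.
Qed.

Lemma enorm_sq n (v : 'cV[R]_n) : enorm v ^+ 2 = \sum_(i < n) v i 0 ^+ 2.
Proof. by rewrite sqr_sqrtr// sumr_ge0// => i _; rewrite sqr_ge0. Qed.

Lemma normr_le_enorm n (v : 'cV[R]_n) (i : 'I_n) : `|v i 0| <= enorm v.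
Proof.
rewrite -(ler_pXn2r (n:=2)) ?nnegrE ?enorm_ge0// enorm_sq real_normK ?num_real//.
by rewrite (bigD1 i)//= lerDl sumr_ge0// => j _; rewrite sqr_ge0.
Qed.

Lemma enorm_sq_col n1 n2 (v : 'cV[R]_(n1 + n2)) :
  enorm v ^+ 2 = enorm (usubmx v) ^+ 2 + enorm (dsubmx v) ^+ 2.
Proof.
rewrite !enorm_sq big_split_ord/=; congr (_ + _).
  by apply: eq_bigr => i _; rewrite mxE.
by apply: eq_bigr => i _; rewrite mxE.
Qed.

Lemma enorm_usubmx_le n1 n2 (v : 'cV[R]_(n1 + n2)) : enorm (usubmx v) <= enorm v.
Proof.
rewrite -(ler_pXn2r (n:=2)) ?nnegrE ?enorm_ge0// (enorm_sq_col v).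
by rewrite lerDl sqr_ge0.
Qed.

Lemma enorm_dsubmx_le n1 n2 (v : 'cV[R]_(n1 + n2)) : enorm (dsubmx v) <= enorm v.
Proof.
rewrite -(ler_pXn2r (n:=2)) ?nnegrE ?enorm_ge0// (enorm_sq_col v).
by rewrite lerDr sqr_ge0.
Qed.

Lemma enorm_le_usubmxD n1 n2 (v : 'cV[R]_(n1 + n2)) :
  enorm v <= enorm (usubmx v) + enorm (dsubmx v).
Proof.
have u0 := enorm_ge0 (usubmx v); have d0 := enorm_ge0 (dsubmx v).
rewrite -(ler_pXn2r (n:=2)) ?nnegrE ?enorm_ge0 ?addr_ge0//.
by rewrite (enorm_sq_col v) sqrrD addrAC lerDl mulrn_wge0// mulr_ge0.
Qed.

(** A neighbourhood of a matrix contains a product of neighbourhoods of its entries, and finitely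
    many entrywise conditions can be met at once. *)
Lemma continuous_mxP (T : topologicalType) m n (f : T -> 'M[R]_(m, n)) :
  (forall i j, continuous (fun t => f t i j)) -> continuous f.
Proof.
move=> cf t A [P fP PA].
apply: (@filterS _ _ _ (fun s => forall i j, P i j (f s i j))).
  by move=> s Ps; apply: PA.
apply: filter_forall => i; apply: filter_forall => j.
exact: cf (fP i j).
Qed.

Lemma enorm_continuous n : continuous (@enorm R n).
Proof.
move=> v; apply: (@continuous_comp _ _ _ (fun v : 'cV[R]_n => \sum_(i < n) v i 0 ^+ 2));
  last exact: sqrt_continuous.
(* Summing over an arbitrary list of indices allows an induction with [n] fixed. *)
have sum_continuous (s : seq 'I_n) :
    continuous (fun v : 'cV[R]_n => \sum_(i <- s) v i 0 ^+ 2).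
  elim: s => [|i s IH] u.
    suff -> : (fun v : 'cV[R]_n => \sum_(i <- [::]) v i 0 ^+ 2) = cst 0.
      exact: cst_continuous.
    by apply/funext => w; rewrite big_nil.
  have -> : (fun v : 'cV[R]_n => \sum_(i <- i :: s) v i 0 ^+ 2) =
      (fun v => v i 0 ^+ 2 + \sum_(i <- s) v i 0 ^+ 2).
    by apply/funext => w; rewrite big_cons.
  apply: cvgD (IH u).
  apply: (@continuous_comp _ _ _ (fun u : 'cV[R]_n => u i 0) (fun r : R => r ^+ 2)).
    exact: coord_continuous.
  exact: exprn_continuous.
exact: sum_continuous.
Qed.

End EuclideanNorm.

(** * Closure properties of the class of comparison functions *)

Section Kinf.
Context {R : realType}.
Implicit Types a b : R -> R.

Lemma max0_continuous : continuous (fun r : R => Num.max 0 r).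
Proof.
move=> r; apply: (@continuous_max R R (fun=> 0) id r); first exact: cst_continuous.
by move=> A.
Qed.

(* Continuity on [0, +oo[ is equivalent to continuity of the extension by a
   constant, for which composition is that of functions on the whole line. *)
Lemma within_ge0_continuousP a :
  {within [set r | 0 <= r], continuous a} <-> continuous (fun r : R => a (Num.max 0 r)).
Proof.
split=> [/subspace_continuousP ca r|ca].
  apply/cvgrPdist_lt => e e0.
  have m0 : 0 <= Num.max 0 r by rewrite le_max lexx.
  have /cvgrPdist_lt/(_ e e0) := ca _ m0.
  rewrite near_withinE => /= h.
  suff : \forall s \near r, `|a (Num.max 0 r) - a (Num.max 0 s)| < e by [].
  have : \forall s \near r, 0 <= Num.max 0 s ->
    `|a (Num.max 0 r) - a (Num.max 0 s)| < e := max0_continuous h.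
  apply: filterS => s; apply.
  by rewrite le_max lexx.
apply/subspace_continuousP => r /= r0; apply/cvgrPdist_lt => e e0.
rewrite near_withinE; have /cvgrPdist_lt/(_ e e0) := ca r.
by apply: filterS => s /[swap] s0; rewrite !max_r.
Qed.

Lemma Kinf_ge0 a r : Kinf a -> 0 <= r -> 0 <= a r.
Proof.
move=> [_ a_lt _ a0]; rewrite le_eqVlt => /predU1P[<-|r0]; first by rewrite a0.
by rewrite -a0; apply/ltW/a_lt => //; rewrite inE// ltW.
Qed.

Lemma Kinf_le a r s : Kinf a -> 0 <= r -> r <= s -> a r <= a s.
Proof.
move=> [_ a_lt _ _] r0; rewrite le_eqVlt => /predU1P[->//|rs].
by apply/ltW/a_lt => //; rewrite inE// (le_trans r0)// ltW.
Qed.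

Lemma Kinf_comp a b : Kinf a -> Kinf b -> Kinf (a \o b).
Proof.
move=> Ka Kb; have [ca a_lt ay a0] := Ka; have [cb b_lt By b0] := Kb.
split.
- apply/within_ge0_continuousP => r.
  (* Clamping the inner value as well changes nothing, since [b] is nonnegative on the half-line;
     the composite then splits into two functions continuous on the whole line. *)
  have -> : (fun r => (a \o b) (Num.max 0 r)) =
      (fun r : R => a (Num.max 0 r)) \o (fun r : R => b (Num.max 0 r)).
    apply/funext => s /=; rewrite (max_r (Kinf_ge0 Kb _))//.
    by rewrite le_max lexx.
  apply: continuous_comp; first exact: (within_ge0_continuousP b).1.
  exact: (within_ge0_continuousP a).1.
- move=> r s r0 s0 rs /=; apply: a_lt.
  + by rewrite inE; exact: Kinf_ge0.
  + by rewrite inE; exact: Kinf_ge0.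
  + exact: b_lt.
- move=> M; have [r r0 Mr] := ay M; have [s s0 rs] := By r.
  by exists s => //=; rewrite (lt_le_trans Mr)//; apply: Kinf_le => //; exact: ltW.
- by rewrite /= b0.
Qed.

Lemma Kinf_add a b : Kinf a -> Kinf b -> Kinf (fun r => a r + b r).
Proof.
move=> Ka Kb; have [ca a_lt ay a0] := Ka; have [cb b_lt By b0] := Kb.
split.
- apply/within_ge0_continuousP => r; apply: cvgD.
    exact: (within_ge0_continuousP a).1.
  exact: (within_ge0_continuousP b).1.
- by move=> r s r0 s0 rs; rewrite ltrD ?a_lt ?b_lt.
- move=> M; have [r r0 Mr] := ay M; exists r => //.
  by rewrite (lt_le_trans Mr)// lerDl Kinf_ge0.
- by rewrite a0 b0 addr0.
Qed.

Lemma Kinf_scale (c : R) : 0 < c -> Kinf (fun r => c * r).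
Proof.
move=> c0; split.
- by apply: continuous_subspaceT; exact: mulrl_continuous.
- by move=> r s _ _; rewrite ltr_pM2l.
- move=> M; exists (c^-1 * (`|M| + 1)).
    by rewrite mulr_ge0// ?invr_ge0 ?addr_ge0// ltW.
  by rewrite mulrA divff ?gt_eqF// mul1r; have := ler_norm M; lra.
- exact: mulr0.
Qed.

Lemma Kinf_sqr : Kinf (fun r : R => r ^+ 2).
Proof.
split.
- apply: continuous_subspaceT; exact: exprn_continuous.
- by move=> r s; rewrite !inE => r0 s0; rewrite ltr_pXn2r.
- move=> M; exists (`|M| + 1); first by rewrite addr_ge0.
  by have := ler_norm M; have := normr_ge0 M; nra.
- by rewrite expr0n.
Qed.

Lemma Kinf_of_increasing a : continuous a -> {homo a : r s / r < s} ->
  (forall r, 0 <= r -> r <= a r) -> a 0 = 0 -> Kinf a.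
Proof.
move=> ca a_lt ge a0; split => //; first exact: continuous_subspaceT.
  by move=> r s _ _; exact: a_lt.
move=> M; exists (`|M| + 1); first by rewrite addr_ge0.
by have := ler_norm M; have := ge (`|M| + 1); have := normr_ge0 M; lra.
Qed.

(** The two one-sided bounds give [a (- |y|) <= y <= a |y|], so the intermediate value theorem makes
    [a] onto, and strict monotonicity makes it injective. Working on the whole line avoids a
    separate argument for continuity of the inverse at the endpoint 0. *)
Lemma Kinf_inverse a : continuous a -> {homo a : r s / r < s} ->
  (forall r, 0 <= r -> r <= a r) -> (forall r, r <= 0 -> a r <= r) ->
  exists2 b, Kinf b & cancel a b.
Proof.
move=> ca a_lt ge le.
have a0 : a 0 = 0 by apply/le_anti/andP; split; [exact: le|exact: ge].
have surj y : exists x, a x == y.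
  have y0 := normr_ge0 y.
  have [x _ xy] : exists2 x, x \in `[(- `|y|), `|y|] & a x = y.
    apply: IVT; first by lra.
      exact: continuous_subspaceT.
    have h1 : a (- `|y|) <= - `|y| by apply: le; lra.
    have h2 := ge `|y| y0.
    have := ler_norm y; have := ler_norm (- y); rewrite normrN => h3 h4.
    by rewrite ge_min le_max; apply/andP; split; apply/orP; [left|right]; lra.
  by exists x; rewrite xy.
pose b y := xchoose (surj y).
have aK : cancel b a by move=> y; apply/eqP; exact: (xchooseP (surj y)).
have a_mono : {mono a : r s / r < s}.
  exact/leW_mono/le_mono.
have bK : cancel a b.
  by move=> r; apply: (inc_inj (le_mono a_lt)); rewrite aK.
have b0 : b 0 = 0 by rewrite -{1}a0 bK.
exists b => //; split => //.
(* Writing [y] as [a (b y)] brings the goal to the form of the local inverse theorem, which gives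
   continuity of a left inverse at an image point. *)
- apply: continuous_subspaceT => y; rewrite -(aK y).
  have near_bK : {near b y, cancel a b} 
    by apply: (@filterE _ (nbhs (b y))) => r; rewrite bK.
  have near_ca : {near b y, continuous a} 
    by apply: (@filterE _ (nbhs (b y))) => r; exact: ca.
  exact: (nbhs_singleton (near_can_continuous near_bK near_ca)).
- by move=> r s _ _; rewrite -{1}(aK r) -{1}(aK s) a_mono.
- move=> M; exists (a (`|M| + 1)).
    by rewrite (le_trans _ (ge _ _)) ?addr_ge0.
  by rewrite bK; have := ler_norm M; lra.
Qed.

End Kinf.

(** * Increasing majorants of continuous maps, by compactness *)

Section Majorant.
Context {R : realType}.

(** Compactness is used for the sup-norm unit ball of row vectors; this inequality places transposed
    Euclidean unit vectors in that ball. *)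
Lemma normr_trmx_le_enorm n (v : 'cV[R]_n) : `|v^T| <= enorm v.
Proof.
rewrite [leLHS]/Num.norm/= mx_normrE; apply/bigmax_leP; split; first exact: enorm_ge0.
by move=> [i j] _ /=; rewrite mxE ord1 normr_le_enorm.
Qed.

Lemma rV_unit_ball_compact n : compact [set v : 'rV[R]_n | `|v| <= 1].
Proof.
apply: bounded_closed_compact.
  by exists 1; split => // M M1 v /= /le_trans; apply; exact: ltW.
have := @preimage_closed _ _ (fun v : 'rV[R]_n => `|v|) [set r : R | r <= 1].
apply; last exact: closed_le.
by move=> v _; exact: norm_continuous.
Qed.

Lemma pairr_continuous (T : topologicalType) (r : R) :
  continuous (fun v : T => (r, v)).
Proof.
move=> v A [[/= U V] [Ur Vv] UV]; suff : nbhs v [set w | A (r, w)] by [].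
apply: (filterS _ Vv) => w Vw; apply: (UV (r, w)); split => //=.
exact: nbhs_singleton.
Qed.

Lemma continuous_has_sup n (F : R * 'rV[R]_n -> R) r : continuous F ->
  has_sup [set F (r, v) | v in [set v | `|v| <= 1]].
Proof.
move=> cF; split; first by exists (F (r, 0)), 0; rewrite //= normr0.
have cFr : continuous (fun v => F (r, v)).
  move=> v; apply: (@continuous_comp _ _ _ (fun v => (r, v)) F); last exact: cF.
  exact: pairr_continuous.
have /compact_bounded[M [_ FM]] :
    compact [set F (r, v) | v in [set v : 'rV[R]_n | `|v| <= 1]].
  apply: continuous_compact (@rV_unit_ball_compact n).
  exact: continuous_subspaceT.
exists (M + 1) => y Fy.
by rewrite (le_trans (ler_norm _))// FM// ltrDl.
Qed.

(** On the compact ball, [F (r, v)] tends to [F (r0, v)] uniformly in [v] as [r] tends to [r0], and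
    two functions within [e] of each other have suprema within [e]. *)
Lemma sup_continuous n (F : R * 'rV[R]_n -> R) : continuous F ->
  continuous (fun r => sup [set F (r, v) | v in [set v | `|v| <= 1]]).
Proof.
move=> cF r0; set B := [set v : 'rV[R]_n | `|v| <= 1].
have B_compact : compact B := @rV_unit_ball_compact n.
have B0 : B 0 by rewrite /B/= normr0.
have F_has_sup r := continuous_has_sup r cF.
apply/cvgrPdist_le => e e0.
(* Compactness turns estimates local in [v] into a single neighbourhood of [r0] that serves the
   whole ball. *)
have /compact_near_coveringP/(_ _ (nbhs r0)
    (fun r v => `|F (r0, v) - F (r, v)| <= e)) := B_compact.
have near_le v : B v -> \forall v' \near v & r \near r0,
    `|F (r0, v') - F (r, v')| <= e.
  move=> _.
  (* Both [F (r0, v')] and [F (r, v')] are compared with [F (r0, v)], at a cost of [e / 2] each. *)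
  have e2 : 0 < e / 2 by rewrite divr_gt0.
  have /cvgrPdist_lt/(_ _ e2) := cF (r0, v).
  have /cvgrPdist_lt/(_ _ e2) : F (r0, v') @[v' --> v] --> F (r0, v).
    apply: (@continuous_comp _ _ _ (fun v => (r0, v)) F); last exact: cF.
    exact: pairr_continuous.
  move=> A1 [[/= U V] [Ur Vv] UV].
  exists ([set v' | `|F (r0, v) - F (r0, v')| < e / 2] `&` V, U) => /=.
    by split => //; exact: filterI.
  move=> [v' r] /= [[h1 Vv'] Ur'].
  have h2 := UV (r, v') (conj Ur' Vv').
  rewrite /= in h2.
  rewrite (_ : _ - _ = (F (r0, v) - F (r, v')) - (F (r0, v) - F (r0, v'))); last by lra.
  by rewrite (le_trans (ler_normB _ _))//; lra.
move=> /(_ _ near_le); apply: filterS => r /= Fr.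
rewrite ler_distl; apply/andP; split.
  rewrite lerBlDr; apply: ge_sup; first by exists (F (r, 0)), 0.
  move=> _ [v Bv <-]; have := Fr _ Bv; rewrite /= ler_distlC => /andP[_ h].
  by rewrite (le_trans h)// lerD2r sup_upper_bound//; exists v.
apply: ge_sup; first by exists (F (r0, 0)), 0.
move=> _ [v Bv <-]; have := Fr _ Bv; rewrite /= ler_distl => /andP[_ h].
by rewrite (le_trans h)// lerD2r sup_upper_bound//; exists v.
Qed.

(** For [r >= 0] the majorant is the maximum of [enorm (T x)] over the sup-norm ball of radius [r],
    plus [r]. The added [r] gives strict growth; the behaviour on negative arguments makes sums of
    such majorants invertible on the whole line. *)
Lemma enorm_majorant n m (T : 'cV[R]_n -> 'cV[R]_m) : continuous T -> T 0 = 0 ->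
  exists rho : R -> R,
    [/\ continuous rho, {homo rho : r s / r < s},
        (forall r, 0 <= r -> r <= rho r), (forall r, r <= 0 -> rho r <= r)
      & forall x, enorm (T x) <= rho (enorm x)].
Proof.
move=> cT T0.
pose F (p : R * 'rV[R]_n) := enorm (T (p.1 *: p.2^T)).
have cF : continuous F.
  move=> p.
  have c1 : continuous (fun p : R * 'rV[R]_n => p.1 *: p.2^T).
    apply: continuous_mxP => i j q.
    have -> : (fun q : R * 'rV[R]_n => (q.1 *: q.2^T) i j) =
        (fun q => q.1 * q.2 j i) by apply/funext => s; rewrite !mxE.
    apply: cvgM; first exact: cvg_fst.
    apply: (@continuous_comp _ _ _ snd (fun v : 'rV[R]_n => v j i)).
      exact: cvg_snd.
    exact: coord_continuous.
  apply: (@continuous_comp _ _ _ (fun p : R * 'rV[R]_n => p.1 *: p.2^T)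
    (fun x => enorm (T x))); first exact: c1.
  by apply: (@continuous_comp _ _ _ T); [exact: cT|exact: enorm_continuous].
have F0 v : F (0, v) = 0 by rewrite /F/= scale0r T0 enorm0.
pose B := [set v : 'rV[R]_n | `|v| <= 1].
have B0 : B 0 by rewrite /B/= normr0.
pose M r := sup [set F (r, v) | v in B].
have cM : continuous M := sup_continuous cF.
have F_le_M r v : B v -> F (r, v) <= M r.
  move=> Bv; apply: sup_upper_bound; last by exists v.
  exact: continuous_has_sup.
have M0 : M 0 = 0.
  rewrite /M (_ : [set F (0, v) | v in B] = [set 0]) ?sup1//.
  apply/seteqP; split => [_ [v _ <-]/=|_ ->]; first exact: F0.
  by exists 0.
have M_le r s : 0 <= r -> r <= s -> M r <= M s.
  move=> r0 rs; have s0 := le_trans r0 rs.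
  have [s_eq0|s_neq0] := eqVneq s 0.
    by have -> : r = s by apply/le_anti; rewrite rs s_eq0.
  apply: ge_sup; first by exists (F (r, 0)), 0.
  move=> _ [v Bv <-].
  (* The ball of radius [r] lies in that of radius [s]: shrinking [v] by [r / s <= 1] keeps it in
     the unit ball. *)
  have -> : F (r, v) = F (s, (r / s) *: v).
    by rewrite /F/= linearZ/= scalerA mulrCA divff// mulr1.
  apply: F_le_M; rewrite /B/= normrZ ger0_norm ?divr_ge0// -[1]mulr1.
  rewrite ler_pM ?divr_ge0// ler_pdivrMr ?mul1r// lt_neqAle s0 andbT.
  by rewrite eq_sym.
have M_ge0 r : 0 <= M r by apply: le_trans (F_le_M r 0 B0); exact: enorm_ge0.
(* [M] is even, hence not increasing on negative arguments; clamping makes it constant there, and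
   the majorant becomes the identity. *)
exists (fun r => M (Num.max 0 r) + r); split.
- move=> r; apply: cvgD; last exact: cvg_id.
  apply: (@continuous_comp _ _ _ (fun r : R => Num.max 0 r) M).
    exact: max0_continuous.
  exact: cM.
- move=> r s rs; apply: ler_ltD => //; apply: M_le.
    by rewrite le_max lexx.
  by rewrite ge_max !le_max lexx/= (ltW rs) orbT.
- by move=> r _; rewrite lerDr.
- by move=> r r0; rewrite (max_l r0) M0 add0r.
- move=> x; have x0 := enorm_ge0 x; rewrite (max_r x0).
  apply: ler_wpDr => //.
  (* The case of norm 0 is separated because the other one divides by the norm, writing [x] as its
     length times a direction in the unit ball. *)
  have [x_eq0|x_neq0] := eqVneq (enorm x) 0.
    have -> : x = 0.
      apply/colP => i; rewrite mxE; apply/eqP; rewrite -normr_le0 -x_eq0.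
      exact: normr_le_enorm.
    by rewrite T0 !enorm0.
  have -> : enorm (T x) = F (enorm x, (enorm x)^-1 *: x^T).
    by rewrite /F/= linearZ/= trmxK scalerA divff// scale1r.
  apply: F_le_M; rewrite /B/= normrZ normfV ger0_norm// ler_pdivrMl ?mulr1.
    exact: normr_trmx_le_enorm.
  by rewrite lt_neqAle eq_sym x_neq0.
Qed.

End Majorant.

(** * Integrals over [[0, t]] for Lebesgue measure *)

Section Integration.
Context {R : realType}.
Implicit Types (f g : R -> R) (t : R).

Lemma borel_leb_measurable (A : set R) :
  measurable (A : set (measurableTypeR R)) -> measurable (A : set (lebesgueType R)).
Proof. exact: sub_caratheodory. Qed.

Lemma leb_measurable_itv (i : interval R) :
  measurable ([set` i] : set (lebesgueType R)).
Proof. by apply: borel_leb_measurable; exact: measurable_itv. Qed.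

Lemma ae_leb_filter : Filter (almost_everywhere (leb R)).
Proof. exact: (ae_filter_ringOfSetsType (leb R)). Qed.

Lemma leb_segment_fin t : (leb R `[0%R, t]%classic < +oo)%E.
Proof.
have -> : leb R `[0, t]%classic = lebesgue_measure (`[0, t]%classic : set R) by [].
by rewrite lebesgue_measure_itv/=; case: ifP => // _; rewrite -EFinB ltry.
Qed.

Lemma continuous_leb_measurable (D : set (lebesgueType R)) f :
  continuous f -> measurable D -> measurable_fun D (f : lebesgueType R -> R).
Proof.
move=> cf mD _ Y mY; apply: measurableI => //; apply: borel_leb_measurable.
rewrite -[X in measurable X]setTI.
have mf : measurable_fun setT (f : measurableTypeR R -> measurableTypeR R).
  exact: continuous_measurable_fun.
exact: mf.
Qed.

Lemma continuous_leb_integrable f t : continuous f ->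
  (leb R).-integrable `[0%R, t]%classic (EFin \o (f : lebesgueType R -> R)).
Proof.
move=> cf; apply: measurable_bounded_integrable.
- exact: leb_measurable_itv.
- exact: leb_segment_fin.
- by apply: continuous_leb_measurable => //; exact: leb_measurable_itv.
- have /compact_bounded[M [Mr fM]] : compact (f @` `[0, t]%classic).
    apply: continuous_compact; last exact: segment_compact.
    exact: continuous_subspaceT.
  by exists M; split => // N MN s s0t; apply: (fM N MN); exists s.
Qed.

(* Measurability of f is not needed: the integral of a nonnegative function is a
   supremum over the simple functions below it. *)
Lemma le_int0 f g t :
  (forall s, 0 <= s <= t -> 0 <= f s <= g s) ->
  (\int[leb R]_(s in `[0%R, t]) (g s)%:E < +oo)%E ->
  int0 f t <= int0 g t.
Proof.
move=> fg g_fin.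
have f0 s : `[0, t]%classic s -> (0 <= (f s)%:E)%E.
  by rewrite /= in_itv/= lee_fin => /fg /andP[].
have g0 s : `[0, t]%classic s -> (0 <= (g s)%:E)%E.
  by rewrite /= in_itv/= lee_fin => /fg /andP[/le_trans] /[apply].
have le_fg : (\int[leb R]_(s in `[0%R, t]) (f s)%:E <=
              \int[leb R]_(s in `[0%R, t]) (g s)%:E)%E.
  rewrite !ge0_integralE//; apply: ge_ereal_sup => _ [h /= hf <-].
  apply: ereal_sup_ubound; exists h => // s; apply: le_trans (hf s) _.
  rewrite /patch; case: ifPn => //; rewrite inE /= in_itv/= => /fg /andP[_].
  by rewrite lee_fin.
apply: fine_le => //; rewrite ge0_fin_numE ?integral_ge0//.
exact: le_lt_trans g_fin.
Qed.

Lemma int0_ge0 f t : (forall s, 0 <= s <= t -> 0 <= f s) -> 0 <= int0 f t.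
Proof.
by move=> f0; apply: Rintegral_ge0 => s; rewrite /= in_itv/=; exact: f0.
Qed.

Lemma eq_int0 f g t : (forall s, 0 <= s <= t -> f s = g s) -> int0 f t = int0 g t.
Proof.
by move=> fg; apply: eq_Rintegral => s; rewrite inE/= in_itv/=; exact: fg.
Qed.

Lemma continuous_le_int0 f g t : continuous g ->
  (forall s, 0 <= s <= t -> 0 <= f s <= g s) -> int0 f t <= int0 g t.
Proof.
move=> cg fg; apply: le_int0 => //.
apply: (integrable_lty (leb_measurable_itv _)).
exact: continuous_leb_integrable.
Qed.

Lemma int0D f g t : continuous f -> continuous g ->
  int0 (fun s => f s + g s) t = int0 f t + int0 g t.
Proof.
move=> cf cg; apply: RintegralD; first exact: leb_measurable_itv.
- exact: continuous_leb_integrable.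
- exact: continuous_leb_integrable.
Qed.

Lemma int0Zl f (c : R) t : continuous f ->
  int0 (fun s => c * f s) t = c * int0 f t.
Proof.
move=> cf; apply: RintegralZl; first exact: leb_measurable_itv.
exact: continuous_leb_integrable.
Qed.

(** An essential bound [M] on the input bounds the integrand almost everywhere by [sigma M ^+ 2] on
    a segment of finite measure. Finiteness matters because [int0] gives 0 to a divergent integral,
    which would break monotonicity. *)
Lemma input_int_fin m (w : R -> 'cV[R]_m) (sigma : R -> R) t :
  input w -> continuous sigma -> {homo sigma : r s / r < s} -> sigma 0 = 0 ->
  (\int[leb R]_(s in `[0%R, t]) (sigma (enorm (w s)) ^+ 2)%:E < +oo)%E.
Proof.
move=> [mw bw] csigma sigma_lt sigma0.
have mD : measurable (`[0, t]%classic : set (lebesgueType R)) := leb_measurable_itv _.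
have sigma_le r s : r <= s -> sigma r <= sigma s.
  by rewrite le_eqVlt => /predU1P[->//|/sigma_lt/ltW].
have [M wM] := bw t.
(* The integrand is [h] of the sum of squared coordinates, so its measurability reduces to that of
   the coordinates of [w]. *)
pose h (r : R) := sigma (Num.sqrt r) ^+ 2.
have ch : continuous h.
  move=> r; apply: (@continuous_comp _ _ _ (fun r => sigma (Num.sqrt r)) (fun r : R => r ^+ 2)).
    apply: (@continuous_comp _ _ _ (@Num.sqrt R) sigma); last exact: csigma.
    exact: sqrt_continuous.
  exact: exprn_continuous.
have mf : measurable_fun (`[0, t]%classic : set (lebesgueType R))
    (fun s : lebesgueType R => sigma (enorm (w s)) ^+ 2).
  apply: (@measurableT_comp _ _ _ _ _ _ (h : measurableTypeR R -> measurableTypeR R)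
    _ (fun s : lebesgueType R => \sum_(i < m) w s i 0 ^+ 2)).
    exact: continuous_measurable_fun.
  apply: measurable_sum => i; 
    apply: (@measurableT_comp _ _ _ _ _ _
      ((fun r => r ^+ 2) : measurableTypeR R -> measurableTypeR R)
      _ (fun s : lebesgueType R => w s i 0)).
    apply: continuous_measurable_fun.
    exact: exprn_continuous.
  apply: measurable_funS (mw i).
    by have := leb_measurable_itv `[0, +oo[; rewrite set_itvcy.
  by move=> s /=; rewrite in_itv/= => /andP[].
pose K := sigma M ^+ 2.
apply: (@le_lt_trans _ _ (\int[leb R]_(s in `[0%R, t]) K%:E)%E).
  apply: ae_ge0_le_integral => //.
  - by move=> s _; rewrite lee_fin sqr_ge0.
  - exact/measurable_EFinP.
  - by move=> s _; rewrite lee_fin sqr_ge0.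
  - move: wM; apply: filterS; first exact: ae_leb_filter.
    move=> s wM; rewrite /= in_itv/= => /wM {}wM.
    have ws0 : 0 <= sigma (enorm (w s)).
      by rewrite -sigma0; apply: sigma_le; exact: enorm_ge0.
    have wsM := sigma_le _ _ wM.
    by rewrite lee_fin ler_pXn2r// nnegrE (le_trans ws0).
rewrite integral_cst// lte_mul_pinfty ?lee_fin ?sqr_ge0//.
exact: leb_segment_fin.
Qed.

End Integration.

(** * Regularity of trajectories and solutions of the cascade *)

Section Solutions.
Context {R : realType}.

(** Absolute continuity is applied to the one interval between the two clamped times; clamping is
    1-Lipschitz, so that interval is short. *)
Lemma abs_continuous_continuous (g : R -> R) :
  (forall b, abs_continuous 0 b g) -> continuous (fun s : R => g (Num.max 0 s)).
Proof.
move=> ac t; apply/cvgrPdist_lt => e e0.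
(* The extra 1 leaves room to the right of [t]; requiring [|t - s| < 1] keeps both clamped times in
   this segment. *)
have [d d0 gd] := ac (Num.max 0 t + 1) e e0.
have md0 : 0 < Num.min d 1 by rewrite lt_min d0 ltr01.
suff : \forall s \near t, `|g (Num.max 0 t) - g (Num.max 0 s)| < e by [].
have : \forall s \near t, `|t - s| < Num.min d 1.
  exact: (nbhsx_ballx t _ md0).
apply: filterS => s; rewrite lt_min => /andP[tsd ts1].
have [p0 q0] : 0 <= Num.max 0 t /\ 0 <= Num.max 0 s by rewrite !le_max !lexx.
have pq_ts : `|Num.max 0 t - Num.max 0 s| <= `|t - s|.
  by case: (leP 0 t) => ?; case: (leP 0 s) => ?;
    rewrite ?subr0 ?sub0r ?subrr ?normr0 ?normr_ge0//;
    rewrite !ler_norml; have := ler_norm (t - s); have := ler_norm (s - t);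
    rewrite (distrC s t); lra.
move: p0 q0 pq_ts; set p := Num.max 0 t; set q := Num.max 0 s => p0 q0 pq_ts.
have pq1 := le_lt_trans pq_ts ts1; have pqd := le_lt_trans pq_ts tsd.
have q_le : q <= p + 1 by move: pq1; rewrite ltr_distlC; lra.
have := gd 1%N (fun=> Num.min p q) (fun=> Num.max p q).
rewrite !big_ord1.
have -> : Num.max p q - Num.min p q = `|p - q|.
  by case: (leP p q) => pq; [rewrite distrC|]; rewrite ger0_norm ?subr_ge0// ltW.
have -> : `|g (Num.max p q) - g (Num.min p q)| = `|g p - g q|.
  by case: (leP p q) => // pq; rewrite distrC.
apply => //.
  move=> _ /=; split; first by rewrite le_min p0 q0.
    by case: (leP p q) => [|/ltW].
  by rewrite ge_max q_le lerDl ler01.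
by move=> i j _ _ _; rewrite !ord1.
Qed.

Lemma solution_continuous n m (f : 'cV[R]_n -> 'cV[R]_m -> 'cV[R]_n) w x :
  solution f w x -> continuous (fun s : R => x (Num.max 0 s)).
Proof.
move=> [ac _]; apply: continuous_mxP => i j; rewrite (ord1 j).
by apply: (@abs_continuous_continuous (fun s => x s i 0)) => b; exact: ac.
Qed.

Lemma solution_sq_continuous n m k (f : 'cV[R]_n -> 'cV[R]_m -> 'cV[R]_n) w x
    (T : 'cV[R]_n -> 'cV[R]_k) :
  solution f w x -> continuous T ->
  continuous (fun s : R => enorm (T (x (Num.max 0 s))) ^+ 2).
Proof.
move=> /solution_continuous cx cT t.
apply: (@continuous_comp _ _ _ (fun s : R => x (Num.max 0 s))
  (fun v => enorm (T v) ^+ 2)); first exact: cx.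
apply: (@continuous_comp _ _ _ T (fun v => enorm v ^+ 2)); first exact: cT.
apply: (@continuous_comp _ _ _ (@enorm R k) (fun r : R => r ^+ 2)).
  exact: enorm_continuous.
exact: exprn_continuous.
Qed.

(** This makes the state of the second system an admissible input of the first. Continuity gives
    both measurability and boundedness on segments. *)
Lemma solution_input n m (f : 'cV[R]_n -> 'cV[R]_m -> 'cV[R]_n) w x :
  solution f w x -> input x.
Proof.
move=> sol; have cx := solution_continuous sol; split.
  move=> i.
  have cxi : continuous (fun s : R => x (Num.max 0 s) i 0).
    move=> s; apply: (@continuous_comp _ _ _ (fun s : R => x (Num.max 0 s))
      (fun v : 'cV[R]_n => v i 0)); first exact: cx.
    exact: coord_continuous.
  apply: (eq_measurable_fun (fun s : lebesgueType R => x (Num.max 0 (s : R)) i 0)).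
    by move=> s; rewrite inE/= => s0; rewrite max_r.
  apply: continuous_leb_measurable => //.
  by have := leb_measurable_itv `[(0 : R), +oo[; rewrite set_itvcy.
move=> b.
have cnx : continuous (fun s : R => enorm (x (Num.max 0 s))).
  move=> s; apply: (@continuous_comp _ _ _ (fun s : R => x (Num.max 0 s))
    (@enorm R n)); first exact: cx.
  exact: enorm_continuous.
have /compact_bounded[M [_ xM]] :
    compact ((fun s : R => enorm (x (Num.max 0 s))) @` `[0, b]%classic).
  apply: continuous_compact; last exact: segment_compact.
  exact: continuous_subspaceT.
exists (M + 1); apply: aeW => s s0b.
apply: le_trans (ler_norm _) _; apply: (xM (M + 1)); first by rewrite ltrDl.
by exists s; rewrite /= ?in_itv//= max_r//; have /andP[] := s0b.
Qed.

Lemma cascade_solutionP n1 n2 m2 (f1 : 'cV[R]_n1 -> 'cV[R]_n2 -> 'cV[R]_n1)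
    (f2 : 'cV[R]_n2 -> 'cV[R]_m2 -> 'cV[R]_n2) w (x : R -> 'cV[R]_(n1 + n2)) :
  solution (cascade f1 f2) w x <->
  solution f1 (fun t => dsubmx (x t)) (fun t => usubmx (x t)) /\
  solution f2 w (fun t => dsubmx (x t)).
Proof.
have usubE i : (fun t => usubmx (x t) i 0) = (fun t => x t (lshift n2 i) 0).
  by apply/funext => t; rewrite mxE.
have dsubE i : (fun t => dsubmx (x t) i 0) = (fun t => x t (rshift n1 i) 0).
  by apply/funext => t; rewrite mxE.
split=> [[ac dx]|[[ac1 dx1] [ac2 dx2]]].
  split; split.
  - by move=> b i; rewrite usubE; exact: ac.
  - move: dx; apply: filterS; first exact: ae_leb_filter.
    move=> t dx t0 i; rewrite usubE.
    by have := dx t0 (lshift n2 i); rewrite /cascade col_mxEu.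
  - by move=> b i; rewrite dsubE; exact: ac.
  - move: dx; apply: filterS; first exact: ae_leb_filter.
    move=> t dx t0 i; rewrite dsubE.
    by have := dx t0 (rshift n1 i); rewrite /cascade col_mxEd.
split.
  move=> b i; case: (split_ordP i) => j ->; first by rewrite -usubE; exact: ac1.
  by rewrite -dsubE; exact: ac2.
move: dx1 dx2; apply: filterS2; first exact: ae_leb_filter.
move=> t d1 d2 t0 i; case: (split_ordP i) => j ->.
  by rewrite -usubE /cascade col_mxEu; exact: d1.
by rewrite -dsubE /cascade col_mxEd; exact: d2.
Qed.

(** The second system does not see the first, so it is solved first and its trajectory is fed to the
    first system. *)
Lemma cascade_complete n1 n2 m2 (f1 : 'cV[R]_n1 -> 'cV[R]_n2 -> 'cV[R]_n1)
    (f2 : 'cV[R]_n2 -> 'cV[R]_m2 -> 'cV[R]_n2) :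
  forward_complete f1 -> forward_complete f2 -> forward_complete (cascade f1 f2).
Proof.
move=> c1 c2 x0 w iw.
have [x2 x20 sol2] := c2 (dsubmx x0) w iw.
have [x1 x10 sol1] := c1 (usubmx x0) x2 (solution_input sol2).
exists (fun t => col_mx (x1 t) (x2 t)); first by rewrite x10 x20 vsubmxK.
apply/cascade_solutionP.
have -> : (fun t => usubmx (col_mx (x1 t) (x2 t))) = x1.
  by apply/funext => t; rewrite col_mxKu.
have -> : (fun t => dsubmx (col_mx (x1 t) (x2 t))) = x2.
  by apply/funext => t; rewrite col_mxKd.
by split.
Qed.

End Solutions.

(** * Return to the original coordinates and the cascade estimate *)

Lemma ler_sqr_ge0 (R : realType) (r s : R) : 0 <= r -> r <= s -> r ^+ 2 <= s ^+ 2.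
Proof. by move=> r0 rs; rewrite ler_pXn2r ?nnegrE// (le_trans r0). Qed.

(** With [q] the square root of the right-hand side, both transformed states have norm at most [q].
    Majorants [r1], [r2] of the inverse maps give [enorm x <= r1 q + r2 q]; inverting [r1 + r2] and
    squaring yields [alpha]. *)
Lemma coordinate_lower_bound (R : realType) n1 n2
    (T1 : 'cV[R]_n1 -> 'cV[R]_n1) (T2 : 'cV[R]_n2 -> 'cV[R]_n2) :
  coordinate_change T1 -> coordinate_change T2 ->
  exists2 alpha : R -> R, Kinf alpha & forall x : 'cV[R]_(n1 + n2),
    alpha (enorm x) <= enorm (T1 (usubmx x)) ^+ 2 + enorm (T2 (dsubmx x)) ^+ 2.
Proof.
move=> [_ T10 [U1 [cU1 TK1 UK1]]] [_ T20 [U2 [cU2 TK2 UK2]]].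
have U10 : U1 0 = 0 by rewrite -[in LHS]T10 TK1.
have U20 : U2 0 = 0 by rewrite -[in LHS]T20 TK2.
have [r1 [cr1 r1_lt r1_ge r1_le U1r]] := enorm_majorant cU1 U10.
have [r2 [cr2 r2_lt r2_ge r2_le U2r]] := enorm_majorant cU2 U20.
have [b Kb bK] : exists2 b, Kinf b & cancel (fun r => r1 r + r2 r) b.
  apply: Kinf_inverse.
  - by move=> r; apply: cvgD; [exact: cr1|exact: cr2].
  - by move=> r s rs; rewrite ltrD ?r1_lt ?r2_lt.
  - by move=> r r0; have := r1_ge r r0; have := r2_ge r r0; lra.
  - by move=> r r0; have := r1_le r r0; have := r2_le r r0; lra.
exists ((fun r => r ^+ 2) \o b); first exact: Kinf_comp Kinf_sqr Kb.
move=> x /=; set u := enorm (T1 _); set d := enorm (T2 _).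
have [u0 d0] : 0 <= u /\ 0 <= d by split; exact: enorm_ge0.
have s0 : 0 <= u ^+ 2 + d ^+ 2 by rewrite addr_ge0// sqr_ge0.
pose q := Num.sqrt (u ^+ 2 + d ^+ 2).
have q0 : 0 <= q := sqrtr_ge0 _.
have qq : q ^+ 2 = u ^+ 2 + d ^+ 2 by rewrite sqr_sqrtr.
have u_q : u <= q by rewrite -(ler_pXn2r (n:=2)) ?nnegrE// qq lerDl sqr_ge0.
have d_q : d <= q by rewrite -(ler_pXn2r (n:=2)) ?nnegrE// qq lerDr sqr_ge0.
have r_le (r : R -> R) s : {homo r : x y / x < y} -> s <= q -> r s <= r q.
  by move=> r_lt; rewrite le_eqVlt => /predU1P[->//|/r_lt/ltW].
have x_q : enorm x <= r1 q + r2 q.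
  rewrite (le_trans (enorm_le_usubmxD x))// lerD//.
    rewrite -(TK1 (usubmx x)); apply: le_trans (U1r _) _; exact: r_le.
  rewrite -(TK2 (dsubmx x)); apply: le_trans (U2r _) _; exact: r_le.
have b_q : b (enorm x) <= q.
  by rewrite -(bK q); apply: Kinf_le x_q => //; exact: enorm_ge0.
by rewrite -qq ler_sqr_ge0// (Kinf_ge0 Kb (enorm_ge0 _)).
Qed.

Theorem theorem8 (R : realType) (n1 n2 m2 : nat)
    (f1 : 'cV[R]_n1 -> 'cV[R]_n2 -> 'cV[R]_n1)
    (f2 : 'cV[R]_n2 -> 'cV[R]_m2 -> 'cV[R]_n2)
    (alpha1 beta1 gamma1 sigma1 alpha2 beta2 gamma2 sigma2 : R -> R)
    (T1 : 'cV[R]_n1 -> 'cV[R]_n1) (S1 : 'cV[R]_n2 -> 'cV[R]_n2)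
    (T2 : 'cV[R]_n2 -> 'cV[R]_n2) (S2 : 'cV[R]_m2 -> 'cV[R]_m2)
    (bhat1 ghat1 bhat2 ghat2 : R -> R)
    (f1_lip : locally_lipschitz_state f1)
    (f2_lip : locally_lipschitz_state f2)
    (f1_complete : forward_complete f1)
    (f2_complete : forward_complete f2)
    (K1 : [/\ Kinf alpha1, Kinf beta1, Kinf gamma1 & Kinf sigma1])
    (K2 : [/\ Kinf alpha2, Kinf beta2, Kinf gamma2 & Kinf sigma2])
    (iISS1 : iISS_estimate f1 alpha1 beta1 gamma1 sigma1)
    (iISS2 : iISS_estimate f2 alpha2 beta2 gamma2 sigma2)
    (T1_coord : coordinate_change T1) (S1_coord : coordinate_change S1)
    (T2_coord : coordinate_change T2) (S2_coord : coordinate_change S2)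
    (Khat1 : Kinf bhat1 /\ Kinf ghat1) (Khat2 : Kinf bhat2 /\ Kinf ghat2)
    (gain1 : L2_gain f1 T1 S1 bhat1 ghat1)
    (gain2 : L2_gain f2 T2 S2 bhat2 ghat2)
    (S1_T2 : exists2 c : R, 0 < c &
       forall zeta : 'cV[R]_n2, enorm (S1 zeta) <= Num.sqrt c * enorm (T2 zeta)) :
  forward_complete (cascade f1 f2) /\
  exists alpha beta gamma sigma : R -> R,
    [/\ Kinf alpha, Kinf beta, Kinf gamma & Kinf sigma] /\
    iISS_estimate (cascade f1 f2) alpha beta gamma sigma.
Proof.
split; first exact: cascade_complete.
have [[Kbhat1 Kghat1] [Kbhat2 Kghat2]] := (Khat1, Khat2).
have [cT1 T10 _] := T1_coord; have [cT2 T20 _] := T2_coord.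
have [cS2 S20 _] := S2_coord.
have [c c0 S1T2] := S1_T2.
have [alpha Kalpha alpha_le] := coordinate_lower_bound T1_coord T2_coord.
have [tau1 [ctau1 tau1_lt tau1_ge tau1_le T1tau]] := enorm_majorant cT1 T10.
have [tau2 [ctau2 tau2_lt tau2_ge tau2_le T2tau]] := enorm_majorant cT2 T20.
have [rho [crho rho_lt rho_ge rho_le S2rho]] := enorm_majorant cS2 S20.
have fix0 (r : R -> R) : (forall s, 0 <= s -> s <= r s) ->
    (forall s, s <= 0 -> r s <= s) -> r 0 = 0.
  by move=> r_ge r_le; apply/le_anti/andP; split; [exact: r_le|exact: r_ge].
have Ktau1 : Kinf tau1 by apply: Kinf_of_increasing => //; exact: fix0.
have Ktau2 : Kinf tau2 by apply: Kinf_of_increasing => //; exact: fix0.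
have rho0 : rho 0 = 0 := fix0 rho rho_ge rho_le.
have Krho : Kinf rho by exact: Kinf_of_increasing.
have Kc := Kinf_scale c0; have Ktwo := @Kinf_scale R 2 (ltr0n _ 2).
have KB1 := Kinf_comp Kbhat1 Ktau1; have KB2 := Kinf_comp Kbhat2 Ktau2.
have Kgc := Kinf_comp Kghat1 Kc.
have KGB := Kinf_comp Kgc KB2.
have KGG := Kinf_comp Kgc Kghat2.
(* Composing the gains leaves three terms in the initial state and two in the input energy. With
   sums [A] and [G] of these, the total is at most [A + G <= max (2 * A) (2 * G)], whence the factor
   2. *)
exists alpha, ((fun r => 2 * r) \o (fun r => ((bhat1 \o tau1) r +
    ((ghat1 \o (fun r => c * r)) \o (bhat2 \o tau2)) r) + (bhat2 \o tau2) r)),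
  ((fun r => 2 * r) \o (fun r => ((ghat1 \o (fun r => c * r)) \o ghat2) r + ghat2 r)),
  ((fun r => r ^+ 2) \o rho).
split.
  split => //.
  - apply: Kinf_comp => //; apply: Kinf_add => //; exact: Kinf_add.
  - by apply: Kinf_comp => //; exact: Kinf_add.
  - exact: Kinf_comp Kinf_sqr Krho.
move=> w x iw /cascade_solutionP[sol1 sol2] t t0.
have ix2 := solution_input sol2.
have := gain1 _ _ ix2 sol1 t t0; have := gain2 _ _ iw sol2 t t0.
set Y := sqL2 (T2 \o _) t; set X := sqL2 (T1 \o _) t.
set W := sqL2 (S2 \o w) t; set V := sqL2 (S1 \o _) t.
set s := int0 (fun u => ((fun r => r ^+ 2) \o rho) (enorm (w u))) t.
move=> Y_le X_le.
have W0 : 0 <= W by apply: int0_ge0 => u _; exact: sqr_ge0.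
have Y0 : 0 <= Y by apply: int0_ge0 => u _; exact: sqr_ge0.
have V0 : 0 <= V by apply: int0_ge0 => u _; exact: sqr_ge0.
(* The choice of [sigma] as the square of the majorant [rho] of [S2] makes this a pointwise
   comparison. *)
have W_le : W <= s.
  apply: le_int0; last exact: input_int_fin.
  move=> u _; rewrite sqr_ge0/=; apply: (ler_sqr_ge0 _ (S2rho _)); exact: enorm_ge0.
have s0 := le_trans W0 W_le.
(* The coupling condition at [zeta = x2], squared and integrated. Time is clamped at 0 so that the
   dominating integrand is continuous on the whole line. *)
have V_le : V <= c * Y.
  have cY := solution_sq_continuous sol2 cT2.
  have -> : Y = int0 (fun u => enorm (T2 (dsubmx (x (Num.max 0 u)))) ^+ 2) t.
    by apply: eq_int0 => u /andP[u0 _]; rewrite max_r.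
  rewrite -int0Zl//; apply: continuous_le_int0.
    by move=> u; apply: cvgM; [exact: cst_continuous|exact: cY].
  move=> u /andP[u0 _]; rewrite sqr_ge0 max_r//= -[c in leRHS](sqr_sqrtr (ltW c0)).
  rewrite -exprMn; apply: (ler_sqr_ge0 _ (S1T2 _)); exact: enorm_ge0.
have XY : int0 (fun u => alpha (enorm (x u))) t <= X + Y.
  have cX := solution_sq_continuous sol1 cT1.
  have cY := solution_sq_continuous sol2 cT2.
  have -> : Y = int0 (fun u => enorm (T2 (dsubmx (x (Num.max 0 u)))) ^+ 2) t.
    by apply: eq_int0 => u /andP[u0 _]; rewrite max_r.
  have -> : X = int0 (fun u => enorm (T1 (usubmx (x (Num.max 0 u)))) ^+ 2) t.
    by apply: eq_int0 => u /andP[u0 _]; rewrite max_r.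
  rewrite -int0D//; apply: continuous_le_int0.
    by move=> u; apply: cvgD; [exact: cX|exact: cY].
  move=> u /andP[u0 _]; rewrite max_r// alpha_le andbT.
  exact: Kinf_ge0 Kalpha (enorm_ge0 _).
apply: le_trans XY _.
have x0_ge0 := enorm_ge0 (x 0).
have tau1_x : enorm (T1 (usubmx (x 0))) <= tau1 (enorm (x 0)).
  apply: le_trans (T1tau _) (Kinf_le Ktau1 (enorm_ge0 _) _).
  exact: enorm_usubmx_le.
have tau2_x : enorm (T2 (dsubmx (x 0))) <= tau2 (enorm (x 0)).
  apply: le_trans (T2tau _) (Kinf_le Ktau2 (enorm_ge0 _) _).
  exact: enorm_dsubmx_le.
set r0 := enorm (x 0) in x0_ge0 tau1_x tau2_x *.
have X_le' : X <= Num.max ((bhat1 \o tau1) r0) (ghat1 (c * Y)).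
  apply: le_trans X_le _; apply: le_max2.
    exact: Kinf_le Kbhat1 (enorm_ge0 _) tau1_x.
  exact: Kinf_le Kghat1 V0 V_le.
have Y_le' : Y <= Num.max ((bhat2 \o tau2) r0) (ghat2 s).
  apply: le_trans Y_le _; apply: le_max2.
    exact: Kinf_le Kbhat2 (enorm_ge0 _) tau2_x.
  exact: Kinf_le Kghat2 W0 W_le.
(* An increasing function commutes with the maximum, so the bound on [Y] passes through the gain of
   the first system. *)
have GY : ghat1 (c * Y) <= Num.max ((ghat1 \o (fun r => c * r)) ((bhat2 \o tau2) r0))
    ((ghat1 \o (fun r => c * r)) (ghat2 s)).
  move: Y_le'; rewrite !le_max => /orP[] h; apply/orP; [left|right];
    exact: Kinf_le Kgc Y0 h.
have B1_ge0 := Kinf_ge0 KB1 x0_ge0; have B2_ge0 := Kinf_ge0 KB2 x0_ge0.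
have GB_ge0 := Kinf_ge0 KGB x0_ge0; have GG_ge0 := Kinf_ge0 KGG s0.
have g_ge0 := Kinf_ge0 Kghat2 s0.
rewrite /= in X_le' Y_le' GY B1_ge0 B2_ge0 GB_ge0 GG_ge0 g_ge0 *.
move: X_le' Y_le' GY B1_ge0 B2_ge0 GB_ge0 GG_ge0 g_ge0.
set B1 := bhat1 _; set B2 := bhat2 _; set GB := ghat1 (c * B2).
set g2 := ghat2 s; set GG := ghat1 (c * g2); set gY := ghat1 (c * Y).
move=> X_le' Y_le' GY B1_ge0 B2_ge0 GB_ge0 GG_ge0 g2_ge0.
rewrite le_max; move: X_le' Y_le' GY; rewrite !le_max.
(* Whichever branch of each maximum holds, [X + Y] is at most the sum of the two groups, hence at
   most twice the larger one. *)
by case: (leP (B1 + GB + B2) (GG + g2)) => AG /orP[] h1 /orP[] h2 /orP[] h3;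
  apply/orP; (right; lra) || (left; lra).
Qed.
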